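(* Consider the iterates generated by the inexact PANOC$^+$ algorithm described in the context. Suppose that the iterates $(x^k)_{k\in\mathbb{N}}$ and $(\bar x^k)_{k\in\mathbb{N}}$ remain bounded (as is the case when $\varphi$ is coercive), and let $\omega$ be the set of limit points of $(\bar x^k)_{k\in\mathbb{N}}$. Then: (i) If, for some $\delta>0$, the iterates $\bar x^k$ are $\delta$-stationary for the proximal subproblem (as defined in the context), and $\mathrm{graph}\,\partial g$ is closed relative to $\mathrm{dom}\,g\times\mathbb{R}^n$, then every $x^\star\in\omega$ is a $\delta$-stationary point for $\varphi$, i.e. $\mathrm{dist}(0,\partial\varphi(x^\star))\le\delta$. (ii) If the sequence $(\bar x^k)_{k\in\mathbb{N}}$ is (eventually, i.e. for all $k$ large enough) uniformly locally optimal (as defined in the context; this is true in the case of exact proximal evaluations, with $r=\infty$ and $\varepsilon_k=0$), then every $x^\star\in\omega$ is stationary for $\varphi$, i.e. $0\in\partial\varphi(x^\star)$, and $\varphi$ is constantly equal to $\varphi_\star:=\lim_{k\to\infty}\Phi_k$ on $\omega$.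
   Context: Standing assumptions: $f:\mathbb{R}^n\to\mathbb{R}$ is differentiable with locally Lipschitz-continuous gradient; $g:\mathbb{R}^n\to\mathbb{R}\cup\{\infty\}$ is proper, lower semicontinuous and $\gamma_g$-prox-bounded, meaning that $\gamma_g\in(0,\infty]$ is the supremum of all $\gamma>0$ for which $g+\tfrac1{2\gamma}\|\cdot\|^2$ is bounded below on $\mathbb{R}^n$; $\varphi:=f+g$ satisfies $\inf\varphi>-\infty$. Write $\mathrm{dom}\,g=\{x:g(x)<\infty\}$. A function $h$ is coercive if $h(x)\to\infty$ as $\|x\|\to\infty$. Subdifferentials: for $h:\mathbb{R}^n\to\mathbb{R}\cup\{\infty\}$, the regular (Fréchet) subdifferential $\hat\partial h(\bar x)$ at $\bar x\in\mathrm{dom}\,h$ is the set of $v$ with $\liminf_{x\to\bar x,\,x\ne\bar x}\frac{h(x)-h(\bar x)-\langle v,x-\bar x\rangle}{\|x-\bar x\|}\ge0$ (empty outside $\mathrm{dom}\,h$); the limiting subdifferential $\partial h(\bar x)$, for $\bar x\in\mathrm{dom}\,h$, is the set of $v$ for which there exist $x^k,v^k$ with $v^k\in\hat\partial h(x^k)$ and $(x^k,v^k,h(x^k))\to(\bar x,v,h(\bar x))$ (empty outside $\mathrm{dom}\,h$). $\mathrm{graph}\,\partial g=\{(x,v):v\in\partial g(x)\}$. For $b>0$ define $\mathcal L_b(x,z,y):=f(x)+g(z)+\langle y,x-z\rangle+\tfrac b2\|x-z\|^2$. Inexact PANOC$^+$. Inputs: $x^0\in\mathbb{R}^n$, $\gamma_0\in(0,\gamma_g)$,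 $D\ge0$, $\alpha,\beta\in(0,1)$, and a fixed reference point $\bar x^{-1}\in\mathrm{dom}\,g$ (used only in Step 4 when $k=0$). Iteration $k=0$ starts at Step 4. For $k=0,1,2,\dots$: Step 1 ($k\ge1$). Set $\gamma_k\leftarrow\gamma_{k-1}$. Step 2 ($k\ge1$). Select any $d^k\in\mathbb{R}^n$ with $\|d^k\|\le D\|\bar x^{k-1}-x^{k-1}\|$ and set $\tau_k=1$. Step 3 ($k\ge1$). Set $x^k=(1-\tau_k)\bar x^{k-1}+\tau_k(x^{k-1}+d^k)$. Step 4. Choose any $\bar x^k\in\mathbb{R}^n$ such that $$\Phi_k:=\mathcal L_{1/\gamma_k}\big(x^k,\bar x^k,-\nabla f(x^k)\big)\le\mathcal L_{1/\gamma_k}\big(x^k,\bar x^{k-1},-\nabla f(x^k)\big).$$ (An exact minimizer of $\mathcal L_{1/\gamma_k}(x^k,\cdot,-\nabla f(x^k))$, i.e. $\bar x^k\in\mathrm{prox}_{\gamma_k g}(x^k-\gamma_k\nabla f(x^k))$, is always admissible.) Step 5. If $f(\bar x^k)>f(x^k)+\langle\nabla f(x^k),\bar x^k-x^k\rangle+\tfrac{\alpha}{2\gamma_k}\|\bar x^k-x^k\|^2$, then set $\gamma_k\leftarrow\gamma_k/2$ and go back to Step 2 if $k>0$ (a new direction may be selected), or to Step 4 if $k=0$. Step 6. If $k>0$ and $\Phi_k>\Phi_{k-1}-\beta\tfrac{1-\alpha}{2\gamma_{k-1}}\|\bar x^{k-1}-x^{k-1}\|^2$, then set $\tau_k\leftarrow\tau_k/2$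 and go back to Step 3. Step 7. Set $k\leftarrow k+1$ and start the next iteration at Step 1. Within iteration $k$ the variables indexed by $k$ may be overwritten several times; after the iteration is completed, $x^k,\bar x^k,\gamma_k,\tau_k,d^k,\Phi_k$ denote the final accepted values. It is assumed throughout that $x^k\ne\bar x^k$ for every (completed) iteration $k$, so that the algorithm produces infinite sequences. (The sequence $(\Phi_k)$ converges to a finite value $\varphi_\star\ge\inf\varphi$.) Suboptimality criteria for the computed $\bar x^k$: - $\delta$-stationary (for $\delta>0$): for each $k$, $\mathrm{dist}\big(0,\partial[\mathcal L_{1/\gamma_k}(x^k,\cdot,-\nabla f(x^k))](\bar x^k)\big)\le\delta$, that is, there exists $\bar v^k\in\partial g(\bar x^k)$ with $\|\bar v^k+\nabla f(x^k)+\tfrac1{\gamma_k}(\bar x^k-x^k)\|\le\delta$. - Uniformly locally optimal: there exist $r>0$ and a sequence $\varepsilon_k\searrow0$ ($\varepsilon_k\ge0$) such that $\mathcal L_{1/\gamma_k}(x^k,\bar x^k,-\nabla f(x^k))\le\mathcal L_{1/\gamma_k}(x^k,x,-\nabla f(x^k))+\varepsilon_k$ for all $x$ with $\|x-\bar x^k\|\le r$. *)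

(* Defs.v *)
From HB Require Import structures.
From mathcomp Require Import all_boot all_order all_algebra.
From mathcomp Require Import all_classical all_reals all_analysis.

Set Implicit Arguments.
Unset Strict Implicit.
Unset Printing Implicit Defensive.
Import Order.TTheory GRing.Theory Num.Theory.
Import numFieldNormedType.Exports.
Local Open Scope classical_set_scope.
Local Open Scope ring_scope.

(* R^n is 'rV[R]_n.  The library norm on 'rV[R]_n is the sup norm, so the
   Euclidean structure is defined here.  Topological notions, boundedness of
   sequences and local Lipschitz continuity, which do not depend on the choice
   of the norm, are the library ones. *)

Section euclidean.
Context {R : realType} {n : nat}.
Implicit Types u v : 'rV[R]_n.

Definition dotrv u v : R := \sum_i u 0 i * v 0 i.

Definition enorm u : R := Num.sqrt (dotrv u u).

(* dist(0, A), equal to +oo when A is empty *)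
Definition dist0 (A : set 'rV[R]_n) : \bar R :=
  ereal_inf [set (enorm v)%:E | v in A].

End euclidean.

Section functions.
Context {R : realType} {n : nat}.
Local Notation E := 'rV[R]_n.
Implicit Types (f : E -> R) (g h : E -> \bar R).

Definition grad f (x : E) : E := \row_i 'D_(delta_mx 0 i) f x.

Definition locally_lipschitz (F : E -> E) : Prop :=
  forall x : E, exists2 U : set E, nbhs x U & [lipschitz F y | y in U].

(* Extended-real-valued functions are meant to take values in R u {+oo}. *)
Definition dom h : set E := [set x | (h x < +oo)%E].

Definition proper_function h : Prop := (forall x, h x != -oo%E) /\ dom h !=set0.

Definition coercive h : Prop :=
  forall M : R, exists r : R, forall x, r <= enorm x -> (M%:E <= h x)%E.

(* Supremum of the proximal parameters for which the regularized function is
   bounded below; it is -oo when there is none. *)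
Definition prox_threshold g : \bar R :=
  ereal_sup [set gam%:E | gam in [set gam : R | 0 < gam /\
    exists m : R, forall x,
      (m%:E <= g x + (1 / (2 * gam) * enorm x ^+ 2)%:E)%E]].

Definition prox (gam : R) g (u : E) : set E :=
  [set w | forall z, (g w + (1 / (2 * gam) * enorm (w - u) ^+ 2)%:E
                   <= g z + (1 / (2 * gam) * enorm (z - u) ^+ 2)%:E)%E].

Definition regular_subdiff h (xb : E) : set E :=
  [set v | dom h xb /\
    (0 <= limf_einf (fun x => (h x - h xb - (dotrv v (x - xb))%:E)
                              * ((enorm (x - xb))^-1)%:E) xb^')%E].

Definition subdiff h (xb : E) : set E :=
  [set v | dom h xb /\
    exists (xs vs : nat -> E),
      [/\ forall k, regular_subdiff h (xs k) (vs k),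
          xs @ \oo --> xb, vs @ \oo --> v & h (xs k) @[k --> \oo] --> h xb]].

Definition graph_subdiff h : set (E * E) := [set p | subdiff h p.1 p.2].

Definition closed_relative_to (T : topologicalType) (A B : set T) : Prop :=
  exists2 C : set T, closed C & A = C `&` B.

Definition cost f g (x : E) : \bar R := ((f x)%:E + g x)%E.

Definition lagrangian f g (b : R) (x z y : E) : \bar R :=
  ((f x)%:E + g z + (dotrv y (x - z))%:E + (b / 2 * enorm (x - z) ^+ 2)%:E)%E.

Definition prox_model f g (gam : R) (x z : E) : \bar R :=
  lagrangian f g (1 / gam) x z (- grad f x).

End functions.

Section panoc.
Context {R : realType} {n : nat}.
Local Notation E := 'rV[R]_n.
Variables (f : E -> R) (g : E -> \bar R) (D alpha beta : R).

Definition step5_fails (gam : R) (x xb : E) : bool :=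
  f xb > f x + dotrv (grad f x) (xb - x)
         + alpha / (2 * gam) * enorm (xb - x) ^+ 2.

(* gam0, x0, xb0: accepted values at the previous iteration *)
Definition step6_fails (gam0 : R) (x0 xb0 : E) (gam : R) (x xb : E) : bool :=
  (prox_model f g gam x xb > prox_model f g gam0 x0 xb0
     - (beta * ((1 - alpha) / (2 * gam0)) * enorm (xb0 - x0) ^+ 2)%:E)%E.

(* Values of gam with which Step 4 can be entered during iteration 0, started
   from x0 with parameter gam_init and reference point xref. *)
Inductive reach0 (gam_init : R) (x0 xref : E) : R -> Prop :=
| Reach0_start : reach0 gam_init x0 xref gam_init
| Reach0_step5 gam xb :
    reach0 gam_init x0 xref gam ->
    (prox_model f g gam x0 xb <= prox_model f g gam x0 xref)%E ->
    step5_fails gam x0 xb ->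
    reach0 gam_init x0 xref (gam / 2).

Definition accepted0 (gam_init : R) (x0 xref : E) (gam : R) (xb : E) : Prop :=
  [/\ reach0 gam_init x0 xref gam,
      (prox_model f g gam x0 xb <= prox_model f g gam x0 xref)%E
    & ~~ step5_fails gam x0 xb].

(* Control points of an iteration k >= 1, with the current values of those
   variables of index k that are set at that point. *)
Inductive control :=
| AtStep2 (gam : R)
| AtStep3 (gam : R) (d : E) (tau : R)
| AtStep4 (gam : R) (d : E) (tau : R) (x : E)
| AtStep5 (gam : R) (d : E) (tau : R) (x xb : E)
| AtStep6 (gam : R) (d : E) (tau : R) (x xb : E)
| AtStep7 (gam : R) (d : E) (tau : R) (x xb : E).

(* Control points reachable during an iteration k >= 1, from the accepted
   values gam0, x0, xb0 of iteration k - 1. *)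
Inductive reach (gam0 : R) (x0 xb0 : E) : control -> Prop :=
| Reach_step1 : reach gam0 x0 xb0 (AtStep2 gam0)
| Reach_step2 gam d :
    reach gam0 x0 xb0 (AtStep2 gam) ->
    enorm d <= D * enorm (xb0 - x0) ->
    reach gam0 x0 xb0 (AtStep3 gam d 1)
| Reach_step3 gam d tau :
    reach gam0 x0 xb0 (AtStep3 gam d tau) ->
    reach gam0 x0 xb0
      (AtStep4 gam d tau ((1 - tau) *: xb0 + tau *: (x0 + d)))
| Reach_step4 gam d tau x xb :
    reach gam0 x0 xb0 (AtStep4 gam d tau x) ->
    (prox_model f g gam x xb <= prox_model f g gam x xb0)%E ->
    reach gam0 x0 xb0 (AtStep5 gam d tau x xb)
| Reach_step5_back gam d tau x xb :
    reach gam0 x0 xb0 (AtStep5 gam d tau x xb) ->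
    step5_fails gam x xb ->
    reach gam0 x0 xb0 (AtStep2 (gam / 2))
| Reach_step5_pass gam d tau x xb :
    reach gam0 x0 xb0 (AtStep5 gam d tau x xb) ->
    ~~ step5_fails gam x xb ->
    reach gam0 x0 xb0 (AtStep6 gam d tau x xb)
| Reach_step6_back gam d tau x xb :
    reach gam0 x0 xb0 (AtStep6 gam d tau x xb) ->
    step6_fails gam0 x0 xb0 gam x xb ->
    reach gam0 x0 xb0 (AtStep3 gam d (tau / 2))
| Reach_step6_pass gam d tau x xb :
    reach gam0 x0 xb0 (AtStep6 gam d tau x xb) ->
    ~~ step6_fails gam0 x0 xb0 gam x xb ->
    reach gam0 x0 xb0 (AtStep7 gam d tau x xb).

(* gam, d, tau, x, xb are the sequences of accepted values of an infinite run;
   d 0 and tau 0 are irrelevant, since iteration 0 does not set them. *)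
Definition panoc_run (gam_init : R) (x0 xref : E)
    (gam : nat -> R) (d : nat -> E) (tau : nat -> R) (x xb : nat -> E) : Prop :=
  [/\ x 0%N = x0,
      accepted0 gam_init x0 xref (gam 0%N) (xb 0%N)
    & forall k, reach (gam k) (x k) (xb k)
        (AtStep7 (gam k.+1) (d k.+1) (tau k.+1) (x k.+1) (xb k.+1))].

Definition Phi (gam : nat -> R) (x xb : nat -> E) (k : nat) : \bar R :=
  prox_model f g (gam k) (x k) (xb k).

Definition delta_stationary (delta : R)
    (gam : nat -> R) (x xb : nat -> E) : Prop :=
  forall k,
    (dist0 (subdiff (prox_model f g (gam k) (x k)) (xb k)) <= delta%:E)%E.

(* The radius r may be +oo. *)
Definition locally_optimal_with (r : \bar R) (eps : nat -> R)
    (gam : nat -> R) (x xb : nat -> E) (k : nat) : Prop :=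
  forall z, ((enorm (z - xb k))%:E <= r)%E ->
    (prox_model f g (gam k) (x k) (xb k)
       <= prox_model f g (gam k) (x k) z + (eps k)%:E)%E.

Definition eventually_uniformly_locally_optimal
    (gam : nat -> R) (x xb : nat -> E) : Prop :=
  exists (r : \bar R) (eps : nat -> R),
    [/\ (0 < r)%E, forall k, 0 <= eps k, nonincreasing_seq eps,
        eps @ \oo --> 0
      & \forall k \near \oo, locally_optimal_with r eps gam x xb k].

End panoc.

(* Main.v *)
Require Import Defs.
From HB Require Import structures.
From mathcomp Require Import all_boot all_order all_algebra.
From mathcomp Require Import all_classical all_reals all_analysis.
From mathcomp Require Import ring lra.

Set Implicit Arguments.
Unset Strict Implicit.
Unset Printing Implicit Defensive.
Import Order.TTheory GRing.Theory Num.Theory.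
Import numFieldNormedType.Exports.
Local Open Scope classical_set_scope.
Local Open Scope ring_scope.

(** The proof rests on the descent of the merit values Phi_k. Passing the
    test of Step 5 makes Phi_k dominate the cost at xb_k, with a surplus
    proportional to the residual |xb_k - x_k|^2 / gam_k; passing the test of
    Step 6 makes Phi_k drop by a multiple of that residual. Since the cost is
    bounded below, (Phi_k) converges and the residuals tend to zero
    ([cost_le_merit], [merit_decrease], [residual_cvg0]). Coercivity then
    confines xb_k to a sublevel set, and x_k stays close to it
    ([coercive_bounded]).

    When the iterates are bounded, the stepsizes stay away from zero
    ([run_gam_bounded_below]). Every point tried by the backtracking loops
    lies in one bounded set: the candidates for x_k because they are convex
    combinations of bounded data, the candidates for xb_k because gam_init is
    below the prox-boundedness threshold of g, which makes the proximal models
    uniformly coercive ([prox_model_sublevel_bounded]). On a compact set the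
    first-order Taylor remainder of f is at most a fixed multiple L of the
    squared distance ([taylor_gap_compact]), so the test of Step 5 cannot fail
    once gam <= alpha / (2 L).

    Consequently (xb_k - x_k) / gam_k tends to zero, and near a limit point
    xs of (xb_k) the gradients of the smooth parts of the models tend to
    grad f xs.

    Case of delta-stationary iterates: subgradients w_k of the models with
    norm at most delta + 1/(k+1) have a limit point ws with norm at most
    delta. Removing the smooth gradient turns w_k into a subgradient of g at
    xb_k, and closedness of the graph gives that ws - grad f xs is a
    subgradient of g at xs; adding grad f xs back, ws is a subgradient of the
    cost ([delta_stationary_cluster]).

    Case of locally optimal iterates: the values merit(k) are compared with
    the models at a fixed z close to xs, and k tends to infinity. This gives
    lim Phi <= g(z) + f(xs) + <grad f xs, z - xs> + |z - xs|^2 / (2 c), where c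
    bounds the stepsizes from below ([locally_optimal_limit_le]). For z = xs,
    together with lower semicontinuity of g, it identifies the cost at xs with
    lim Phi; for the other z it then says that - grad f xs is a regular
    subgradient of g at xs. Differentiating only this limit inequality
    bypasses approximate criticality conditions at the inexact minimisers
    ([locally_optimal_cluster]). *)

(** * Euclidean and sup norms on row vectors *)

Section euclidean_facts.
Context {R : realType} {n : nat}.
Implicit Types u v w : 'rV[R]_n.

Lemma dotrvC u v : dotrv u v = dotrv v u.
Proof. by apply: eq_bigr => i _; rewrite mulrC. Qed.

Lemma dotrvDl u v w : dotrv (u + v) w = dotrv u w + dotrv v w.
Proof.
by rewrite /dotrv -big_split; apply: eq_bigr => i _; rewrite mxE mulrDl.
Qed.

Lemma dotrvZl (a : R) u v : dotrv (a *: u) v = a * dotrv u v.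
Proof.
by rewrite /dotrv big_distrr; apply: eq_bigr => i _; rewrite mxE /= mulrA.
Qed.

Lemma dotrvNl u v : dotrv (- u) v = - dotrv u v.
Proof. by rewrite -scaleN1r dotrvZl mulN1r. Qed.

Lemma dotrvDr u v w : dotrv u (v + w) = dotrv u v + dotrv u w.
Proof. by rewrite dotrvC dotrvDl !(dotrvC _ u). Qed.

Lemma dotrvZr (a : R) u v : dotrv u (a *: v) = a * dotrv u v.
Proof. by rewrite dotrvC dotrvZl dotrvC. Qed.

Lemma dotrvNr u v : dotrv u (- v) = - dotrv u v.
Proof. by rewrite dotrvC dotrvNl dotrvC. Qed.

Lemma dotrv0r u : dotrv u 0 = 0.
Proof. by rewrite -(scale0r (0 : 'rV[R]_n)) dotrvZr mul0r. Qed.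

Definition dotrvE := (dotrvDl, dotrvDr, dotrvNl, dotrvNr, dotrvZl, dotrvZr).

Lemma dotrv_ge0 v : 0 <= dotrv v v.
Proof. by apply: sumr_ge0 => i _; rewrite -expr2 sqr_ge0. Qed.

Lemma enorm_ge0 v : 0 <= enorm v.
Proof. exact: sqrtr_ge0. Qed.

Lemma sqr_enorm v : enorm v ^+ 2 = dotrv v v.
Proof. by rewrite sqr_sqrtr // dotrv_ge0. Qed.

Lemma enormN v : enorm (- v) = enorm v.
Proof. by rewrite /enorm !dotrvE opprK. Qed.

Lemma enorm0 : enorm (0 : 'rV[R]_n) = 0.
Proof. by rewrite /enorm dotrv0r sqrtr0. Qed.

Lemma coord_le_normr v i : `|v 0 i| <= `|v|.
Proof.
rewrite -[leRHS]/(mx_norm v) mx_normrE.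
exact: (le_bigmax _ (fun ij : 'I_1 * 'I_n => `|v ij.1 ij.2|) (0, i)).
Qed.

Lemma normr_dotrv_le u v : `|dotrv u v| <= n%:R * `|u| * `|v|.
Proof.
apply: (le_trans (ler_norm_sum _ _ _)).
apply: (@le_trans _ _ (\sum_(i < n) `|u| * `|v|)).
  by apply: ler_sum => i _; rewrite normrM ler_pM // coord_le_normr.
by rewrite sumr_const card_ord -mulrA mulr_natl.
Qed.

Lemma normr_le_enorm v : `|v| <= enorm v.
Proof.
rewrite -[leLHS]/(mx_norm v) mx_normrE; apply: bigmax_le => [|[i j] _ /=].
  exact: enorm_ge0.
rewrite -(ler_pXn2r (n := 2)) ?nnegrE ?enorm_ge0 // sqr_enorm real_normK ?num_real //.
rewrite (ord1 i) /dotrv (bigD1 j) //= expr2 lerDl.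
by apply: sumr_ge0 => k _; rewrite -expr2 sqr_ge0.
Qed.

Lemma enorm_le_normr v : enorm v <= n%:R * `|v|.
Proof.
rewrite -(ler_pXn2r (n := 2)) ?nnegrE ?enorm_ge0 ?mulr_ge0 // sqr_enorm.
apply: (le_trans (ler_norm _)); apply: (le_trans (normr_dotrv_le _ _)).
rewrite exprMn -mulrA -expr2 ler_wpM2r ?sqr_ge0 //.
by rewrite -natrX ler_nat; case: (n) => // m; rewrite leq_pmull.
Qed.

Lemma dotrv_cvg (T : Type) (F : set_system T) (FF : Filter F)
    (a b : T -> 'rV[R]_n) u v :
  a @ F --> u -> b @ F --> v -> dotrv (a t) (b t) @[t --> F] --> dotrv u v.
Proof.
move=> au bv; apply: cvg_big => [|i _]; first exact: add_continuous.
apply: cvgM.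
  by exact: (cvg_comp a (fun M : 'rV[R]_n => M 0 i) au (@coord_continuous _ _ _ _ _ _)).
by exact: (cvg_comp b (fun M : 'rV[R]_n => M 0 i) bv (@coord_continuous _ _ _ _ _ _)).
Qed.

Lemma enorm_cvg (T : Type) (F : set_system T) (FF : Filter F)
    (a : T -> 'rV[R]_n) u :
  a @ F --> u -> enorm (a t) @[t --> F] --> enorm u.
Proof.
move=> au.
exact: (cvg_comp (fun t => dotrv (a t) (a t)) Num.sqrt
  (dotrv_cvg FF au au) (@sqrt_continuous _ _)).
Qed.

Lemma closed_ball_rV_compact (M : R) : compact [set v : 'rV[R]_n | `|v| <= M].
Proof.
apply: bounded_closed_compact.
  by exists M; split; [exact: num_real | move=> x Mx v /= /le_trans; apply; exact: ltW].
rewrite (_ : [set v | _] = (fun v : 'rV[R]_n => `|v|) @^-1` [set r | r <= M]) //.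
apply: preimage_closed => [v _|]; [exact: norm_continuous|exact: closed_le].
Qed.

End euclidean_facts.

(** * Gradients and Taylor remainders *)

Section gradient.
Context {R : realType} {n : nat}.
Implicit Types (f : 'rV[R]_n -> R) (p x y : 'rV[R]_n).

Lemma diff_grad f x v : differentiable f x -> 'd f x v = dotrv (grad f x) v.
Proof.
move=> df; rewrite {1}(row_sum_delta v) linear_sum; apply: eq_bigr => i _.
by rewrite linearZ /= mxE deriveE // mulrC.
Qed.

(** Differentiability is with respect to the sup norm; the sup norm being below
    the Euclidean one, the remainder is also small for the latter. *)
Lemma grad_first_order f x (e : R) : differentiable f x -> 0 < e ->
  \forall y \near x,
    `|f y - f x - dotrv (grad f x) (y - x)| <= e * enorm (y - x).
Proof.
move=> df e0; have /diff_locallyP[_ /eqaddoP fE] := df.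
have /nbhs_norm0P[r /= r0 fEr] := fE _ e0.
apply/nbhs_normP; exists r => //= y yr; have : `|y - x| < r by rewrite distrC.
move=> /fEr; rewrite !fctE /= subrK opprD addrA diff_grad //.
move=> /le_trans; apply.
by rewrite ler_pM2l // normr_le_enorm.
Qed.

Lemma locally_lipschitz_continuous (F : 'rV[R]_n -> 'rV[R]_n) :
  locally_lipschitz F -> continuous F.
Proof.
move=> lF x; have [U Ux /pinfty_ex_gt0[M M0 lU]] := lF x.
apply/(@cvgrPdist_le _ _ _ _ (nbhs_filter x)) => e e0.
have eM : \forall y \near x, `|x - y| < M^-1 * e.
  by apply/nbhs_normP; exists (M^-1 * e) => //=; rewrite mulr_gt0 ?invr_gt0.
apply: (filterS2 _ _ Ux eM) => y Uy /ltW; rewrite ler_pdivlMl // => xyM.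
apply: le_trans xyM; exact: (lU (x, y) (conj (nbhs_singleton Ux) Uy)).
Qed.

Lemma mean_value_grad f x y : (forall z, differentiable f z) ->
  exists2 t : R, 0 <= t <= 1 &
    f y - f x = dotrv (grad f (x + t *: (y - x))) (y - x).
Proof.
move=> df; pose l : R -> 'rV[R]_n := cst x + ( *:%R^~ (y - x)).
have lE t : l t = x + t *: (y - x) by [].
have dl t : is_diff t l ( *:%R^~ (y - x)).
  have := is_diffD (is_diff_cst x t) (is_diff_scalel t (y - x)).
  by rewrite add0r.
have dphi t : is_derive t (1:R) (f \o l) (dotrv (grad f (l t)) (y - x)).
  have dfl : is_diff (l t) f ('d f (l t)) by exact: differentiableP.
  have dd : differentiable (f \o l) t by exact: differentiable_comp.
  apply: DeriveDef; first exact: diff_derivable.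
  by rewrite deriveE // diff_val /= scale1r diff_grad.
have phic : {within `[0, 1], continuous (f \o l)}.
  apply: continuous_subspaceT => t; apply: differentiable_continuous.
  by apply/derivable1_diffP; exact: ex_derive.
have [t] := @MVT_segment R (f \o l) _ 0 1 ler01 (fun t _ => dphi t) phic.
rewrite in_itv /= subr0 mulr1 !lE => t01.
rewrite scale0r scale1r addr0 [x + _]addrC subrK => ->.
by exists t.
Qed.

(** Bounding this remainder by L |y - x|^2 is the descent lemma; only that
    one-sided bound matters for the test of Step 5. *)
Definition taylor_gap f x y : R := f y - f x - dotrv (grad f x) (y - x).

(** The mean value theorem writes the remainder as <grad f z - grad f x, y - x>
    with z on the segment, hence in the same ball, where grad f is Lipschitz. *)
Lemma taylor_gap_near_diagonal f p : (forall z, differentiable f z) ->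
  locally_lipschitz (grad f) ->
  exists L : R, \forall q \near (p, p),
    taylor_gap f q.1 q.2 <= L * enorm (q.2 - q.1) ^+ 2.
Proof.
move=> df lf; have [U /nbhs_normP[r /= r0 rU] /pinfty_ex_gt0[M M0 lU]] := lf p.
have pr : \forall z \near p, `|p - z| < r by apply/nbhs_normP; exists r.
exists (n%:R * M); exists ([set z | `|p - z| < r], [set z | `|p - z| < r]) => //=.
move=> [x y] /= [px py]; have [t /andP[t0 t1] fE] := mean_value_grad x y df.
set z := x + _ in fE.
have pz : `|p - z| < r.
  have -> : p - z = (1 - t) *: (p - x) + t *: (p - y).
    by rewrite /z !scalerBr !scalerBl !scale1r; apply/rowP => i; rewrite !mxE; ring.
  apply: (le_lt_trans (ler_normD _ _)); rewrite !normrZ.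
  rewrite (ger0_norm t0) ger0_norm ?subr_ge0 //.
  have [<-|tn0] := eqVneq 0 t; first by rewrite subr0 mul1r mul0r addr0.
  have : t * `|p - y| < t * r by rewrite ltr_pM2l // lt_neqAle tn0.
  have : (1 - t) * `|p - x| <= (1 - t) * r by rewrite ler_wpM2l ?subr_ge0 // ltW.
  lra.
rewrite /taylor_gap fE -dotrvNl -dotrvDl.
apply: (le_trans (ler_norm _)); apply: (le_trans (normr_dotrv_le _ _)).
rewrite -!mulrA ler_wpM2l //.
have gz : `|grad f z - grad f x| <= M * `|z - x|.
  exact: (lU (z, x) (conj (rU _ pz) (rU _ px))).
have zx : `|z - x| <= `|y - x|.
  by rewrite /z addrAC subrr add0r normrZ ger0_norm // ler_piMl.
have yx := normr_le_enorm (y - x).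
rewrite expr2 mulrA ler_pM // (le_trans gz) // ler_pM2l //.
exact: le_trans zx yx.
Qed.

Lemma taylor_gap_continuous f : (forall z, differentiable f z) ->
  continuous (grad f) ->
  continuous (fun q : 'rV[R]_n * 'rV[R]_n => taylor_gap f q.1 q.2).
Proof.
move=> df cg q.
have c1 : (fun q : 'rV[R]_n * 'rV[R]_n => q.1) @ q --> q.1 by exact: cvg_fst.
have c2 : (fun q : 'rV[R]_n * 'rV[R]_n => q.2) @ q --> q.2 by exact: cvg_snd.
have fc z : {for z, continuous f} by exact: differentiable_continuous.
apply: cvgB; first apply: cvgB.
- exact: (cvg_comp _ f c2 (fc q.2)).
- exact: (cvg_comp _ f c1 (fc q.1)).
apply: dotrv_cvg; first exact: (cvg_comp _ (grad f) c1 (cg q.1)).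
exact: (cvgB c2 c1).
Qed.

(** The constant exists locally around each pair of points: near the diagonal by
    the previous lemma, and elsewhere because the remainder is locally bounded
    while the distance stays away from zero. Compactness of K * K makes it
    uniform. *)
Lemma taylor_gap_compact f (K : set 'rV[R]_n) : (forall z, differentiable f z) ->
  locally_lipschitz (grad f) -> compact K ->
  exists2 L : R, 0 < L &
    forall x y, K x -> K y -> taylor_gap f x y <= L * enorm (y - x) ^+ 2.
Proof.
move=> df lf cK.
have /compact_near_coveringP cKK := compact_setX cK cK.
pose P (L : R) (q : 'rV[R]_n * 'rV[R]_n) :=
  taylor_gap f q.1 q.2 <= L * enorm (q.2 - q.1) ^+ 2.
have near_P (q : 'rV[R]_n * 'rV[R]_n) : \forall q' \near q & L \near +oo, P L q'.
  case: q => p p'; have [<-|pp'] := eqVneq p p'.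
    have [L0 nL0] := taylor_gap_near_diagonal p df lf.
    exists ([set q | taylor_gap f q.1 q.2 <= L0 * enorm (q.2 - q.1) ^+ 2],
            [set L | L0 <= L]).
      by split => //=; exact: nbhs_pinfty_ge (num_real _).
    move=> [q L] /= [qL0 L0L]; apply: (le_trans qL0).
    by rewrite ler_wpM2r ?sqr_ge0.
  pose c := `|p' - p|; have c0 : 0 < c by rewrite normr_gt0 subr_eq0 eq_sym.
  pose C := `|taylor_gap f p p'| + 1; have C0 : 0 < C by rewrite ltr_wpDl.
  have cg := locally_lipschitz_continuous lf.
  exists ([set q | taylor_gap f q.1 q.2 < C /\ c / 2 < `|q.2 - q.1| ],
          [set L | C / (c / 2) ^+ 2 <= L]).
    split => /=; last exact: nbhs_pinfty_ge (num_real _).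
    apply: filterI.
      have tc := @taylor_gap_continuous f df cg (p, p').
      apply: (cvgr_lt _ tc) => /=.
      by rewrite /C (le_lt_trans (ler_norm _)) // ltrDl.
    have qc : `|q.2 - q.1| @[q --> (p, p')] --> c.
      by apply: cvg_norm; apply: cvgB; [exact: cvg_snd|exact: cvg_fst].
    by apply: (cvgr_gt _ qc); rewrite ltr_pdivrMr // ltr_pMr ?ltr1n.
  move=> [q L] /= [[qC cq] CL]; apply: (le_trans (ltW qC)).
  rewrite ler_pdivrMr ?exprn_gt0 ?divr_gt0 // in CL; apply: (le_trans CL).
  have L0 : 0 <= L.
    by rewrite -(@pmulr_lge0 _ ((c / 2) ^+ 2)) ?(le_trans (ltW C0)) // exprn_gt0 ?divr_gt0.
  rewrite ler_wpM2l // ler_pXn2r ?nnegrE ?enorm_ge0 ?divr_ge0 // ?(ltW c0) //.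
  exact: le_trans (ltW cq) (normr_le_enorm _).
have : \forall L \near +oo, K `*` K `<=` P L.
  by apply: cKK => q _; exact: near_P.
move=> /pinfty_ex_gt0[L L0 KL].
by exists L => // x y Kx Ky; exact: (KL (x, y)).
Qed.

End gradient.

(** * Sequences of row vectors *)

Section sequences_in_rV.
Context {R : realType} {n : nat}.
Local Notation E := 'rV[R]_n.

Lemma bounded_fun_gt0 (u : nat -> E) : bounded_fun u ->
  exists2 B, 0 < B & forall k, `|u k| <= B.
Proof. by move=> /pinfty_ex_gt0[B B0 uB]; exists B => // k; exact: uB. Qed.

Lemma norm_bounded_fun (u : nat -> E) B : (forall k, `|u k| <= B) -> bounded_fun u.
Proof.
move=> uB; exists B; split; first exact: num_real.
by move=> r Br k _; apply: le_trans (uB k) (ltW Br).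
Qed.

Lemma continuous_bounded_on_ball (V : normedModType R) (F : E -> V) (B : R) :
  continuous F -> exists C : R, forall z, `|z| <= B -> `|F z| <= C.
Proof.
move=> cF.
have /compact_bounded[C [_ FC]] : compact (F @` [set z : E | `|z| <= B]).
  apply: continuous_compact; last exact: closed_ball_rV_compact.
  exact: continuous_subspaceT.
exists (C + 1) => z zB; apply: (FC (C + 1) _ (F z)); [by rewrite ltrDl|by exists z].
Qed.

Lemma extraction_cvg (phi : nat -> nat) : (forall k, (k <= phi k)%N) ->
  phi @ \oo --> \oo.
Proof.
move=> phi_ge A [N _ NA]; exists N => // k /= Nk.
by apply: NA => /=; exact: leq_trans (phi_ge k).
Qed.

(** [k <= phi k] is enough to transport limits, and it is stable under
    composition of extractions. *)
Lemma cluster_extraction (u : nat -> E) a : cluster (u @ \oo) a ->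
  exists2 phi : nat -> nat, (forall k, (k <= phi k)%N) & u \o phi @ \oo --> a.
Proof.
move=> ua.
have [phi phiP] : {phi : nat -> nat &
    forall k, (k <= phi k)%N /\ `|a - u (phi k)| < k.+1%:R^-1}.
  apply: (@choice _ _ (fun k j => (k <= j)%N /\ `|a - u j| < k.+1%:R^-1)) => k.
  have k0 : 0 < k.+1%:R^-1 :> R by rewrite invr_gt0.
  have aV : \forall z \near a, `|a - z| < k.+1%:R^-1.
    by apply/nbhs_normP; exists k.+1%:R^-1.
  have [||_ [[j kj <-] aj]] :=
    ua [set u j | j in [set j | (k <= j)%N]] [set z | `|a - z| < k.+1%:R^-1].
  - by exists k => // j kj; exists j.
  - exact: aV.
  by exists j.
exists phi => [k|]; first by have [] := phiP k.
apply/cvgrPdist_lt => e e0.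
have [N _ NP] := near_infty_natSinv_lt (PosNum e0).
exists N => // k Nk; have [_ /lt_trans] := phiP k; apply.
exact: NP.
Qed.

Lemma bounded_cluster (u : nat -> E) B : (forall k, `|u k| <= B) ->
  exists a, cluster (u @ \oo) a.
Proof.
move=> uB; have [|a [_ ua]] := @closed_ball_rV_compact R n B (u @ \oo) _.
  by exists 0%N => // k _; exact: uB.
by exists a.
Qed.

(** The form of lower semicontinuity used at limit points, where the values of
    g along the sequence are only controlled from above. *)
Lemma lsc_le_lim (g : E -> \bar R) (u : nat -> E) (b : nat -> R) a l :
  lower_semicontinuous g -> u @ \oo --> a -> b @ \oo --> l ->
  (forall k, (g (u k) <= (b k)%:E)%E) -> (g a <= l%:E)%E.
Proof.
move=> lsc ua bl gub; rewrite leNgt; apply/negP => lt_l.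
have [r lr rg] : exists2 r : R, l < r & (r%:E < g a)%E.
  move: lt_l; case: (g a) => [s| |] //.
    by rewrite lte_fin => ls; exists ((l + s) / 2); rewrite ?lte_fin; lra.
  by move=> _; exists (l + 1); rewrite ?ltrDl ?ltry.
have [V aV Vr] := lsc _ _ rg.
have [N1 _ NV] := ua _ aV; have [N2 _ Nb] := cvgr_lt _ bl _ lr.
pose k := maxn N1 N2.
have := Vr _ (NV k (leq_maxl _ _)).
rewrite ltNge (le_trans (gub k)) // lee_fin ltW //.
exact: Nb (leq_maxr _ _).
Qed.

End sequences_in_rV.

(** * Subdifferentials and smooth perturbations *)

Section subdifferential.
Context {R : realType} {n : nat}.
Local Notation E := 'rV[R]_n.
Implicit Types (g h : E -> \bar R) (q : E -> R) (G : E -> E).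

(** The limit inferior of difference quotients in affine-minorant form, which is
    stable under addition and needs no division in extended arithmetic. *)
Lemma regular_subdiffP h (x v : E) : (forall z, h z != -oo%E) ->
  regular_subdiff h x v <->
  dom h x /\ forall e : R, 0 < e -> \forall z \near x,
    (h x + (dotrv v (z - x) - e * enorm (z - x))%:E <= h z)%E.
Proof.
move=> hNy; split=> -[domx hx]; split=> //; move: domx hx; rewrite /dom /=;
  have := hNy x; case hxE : (h x) => [a| |] // _ _.
  rewrite limf_einfE => sup0 e e0.
  have : ((- e)%:E < ereal_sup
      [set ereal_inf [set (h z - a%:E - (dotrv v (z - x))%:E) * ((enorm (z - x))^-1)%:E
         | z in V] | V in x^'])%E.
    by apply: lt_le_trans sup0; rewrite lte_fin oppr_lt0.
  move=> /ereal_sup_gt[_ [V Vx <-] eV].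
  have {}Vx : \forall z \near x, z != x -> V z := Vx.
  apply: filterS Vx => z Vz.
  have [->|zx] := eqVneq z x.
    rewrite subrr enorm0 mulr0 subr0 hxE dotrv0r.
    by rewrite lee_fin addr0.
  have N0 : 0 < enorm (z - x).
    by rewrite (lt_le_trans _ (normr_le_enorm _)) // normr_gt0 subr_eq0.
  have : ((- e)%:E < (h z - a%:E - (dotrv v (z - x))%:E) * ((enorm (z - x))^-1)%:E)%E.
    by apply: (lt_le_trans eV); apply: ereal_inf_lbound; exists z => //; exact: Vz.
  have := hNy z; case: (h z) => [r| |] //= _.
    rewrite lte_fin lee_fin ltr_pdivlMr //; lra.
  by rewrite leey.
rewrite limf_einfE => near_h; apply/lee_addgt0Pr => e e0.
rewrite -leeBlDr // sub0e -EFinN.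
pose V := [set z | z != x /\ (a%:E + (dotrv v (z - x) - e * enorm (z - x))%:E <= h z)%E].
apply: (@le_trans _ _
  (ereal_inf [set (h z - a%:E - (dotrv v (z - x))%:E) * ((enorm (z - x))^-1)%:E | z in V])%E).
  apply: le_ereal_inf_tmp => _ [z [zx hz] <-].
  have N0 : 0 < enorm (z - x).
    by rewrite (lt_le_trans _ (normr_le_enorm _)) // normr_gt0 subr_eq0.
  move: hz; have := hNy z; case: (h z) => [r| |] //= _.
    rewrite -EFinD !lee_fin ler_pdivlMr //; lra.
  by move=> _; rewrite gt0_mulye ?leey // lte_fin invr_gt0.
apply: ereal_sup_ubound; exists V => //; rewrite /dnbhs.
by apply: filterS (near_h e e0) => z hz zx; split.
Qed.

(** A Frechet gradient field given explicitly, so that the proximal models, whose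
    gradients are known in closed form, need no computation of partial
    derivatives. *)
Definition has_gradient q G := forall x (e : R), 0 < e ->
  \forall z \near x, `|q z - q x - dotrv (G x) (z - x)| <= e * enorm (z - x).

Lemma has_gradientN q G : has_gradient q G -> has_gradient (\- q) (\- G).
Proof.
move=> qG x e e0; apply: filterS (qG x e e0) => z; apply: le_trans.
by rewrite /= -normrN dotrvNl le_eqVlt; apply/orP; left; apply/eqP; congr `|_|; ring.
Qed.

Lemma regular_subdiffD g q G x v : (forall z, g z != -oo%E) ->
  has_gradient q G -> regular_subdiff g x v ->
  regular_subdiff (fun z => g z + (q z)%:E)%E x (v + G x).
Proof.
move=> gNy qG /(regular_subdiffP _ _ gNy)[domx gx].
apply/regular_subdiffP.
  by move=> z; have := gNy z; case: (g z).
split; first by move: domx; rewrite /dom /=; case: (g x) => //= r; rewrite -EFinD !ltry.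
move=> e e0; have e20 : 0 < e / 2 by rewrite divr_gt0.
apply: (filterS2 _ _ (gx _ e20) (qG x _ e20)) => z.
have := gNy z; have := gNy x; move: domx; rewrite /dom /=.
case: (g x) => [a| |] // _ _; case: (g z) => [b| |] // _; last by rewrite !leey.
rewrite -!EFinD !lee_fin ler_norml dotrvDl => gz /andP[qz _]; lra.
Qed.

Lemma subdiffD g q G x v : (forall z, g z != -oo%E) ->
  has_gradient q G -> continuous q -> continuous G -> subdiff g x v ->
  subdiff (fun z => g z + (q z)%:E)%E x (v + G x).
Proof.
move=> gNy qG cq cG [domx [xs [vs [xvs xsx vsv gxs]]]].
split; first by move: domx; rewrite /dom /=; case: (g x) => //= r; rewrite -EFinD !ltry.
exists xs, (fun k => vs k + G (xs k)); split.
- by move=> k; exact: regular_subdiffD.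
- by [].
- by apply: cvgD => //; exact: (cvg_comp _ G xsx (cG x)).
apply: cvgeD => //; first by rewrite fin_num_adde_defl.
by apply: cvg_EFin; [exact: nearW|exact: (cvg_comp _ q xsx (cq x))].
Qed.

(** A smooth perturbation is undone by the opposite one, so that the inclusion of
    [subdiffD] is in fact an equality. *)
Lemma subdiffB g q G x v : (forall z, g z != -oo%E) ->
  has_gradient q G -> continuous q -> continuous G ->
  subdiff (fun z => g z + (q z)%:E)%E x v -> subdiff g x (v - G x).
Proof.
move=> gNy qG cq cG /subdiffD => /(_ (\- q) (\- G)).
have -> : (fun z => g z + (q z)%:E + ((\- q) z)%:E)%E = g.
  apply/funext => z; have := gNy z; case: (g z) => // r _.
  by rewrite -!EFinD addrK.
apply; first by move=> z; have := gNy z; case: (g z).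
- exact: has_gradientN.
- by move=> z; exact: (cvgN (cq z)).
- by move=> z; exact: (cvgN (cG z)).
Qed.

Lemma regular_subdiff_subdiff h x v : (forall z, h z != -oo%E) ->
  regular_subdiff h x v -> subdiff h x v.
Proof.
move=> hNy hv; have [domx _] := hv; split => //.
by exists (fun=> x), (fun=> v); split => //; exact: cvg_cst.
Qed.

End subdifferential.

(** * The proximal model *)

Section prox_model.
Context {R : realType} {n : nat}.
Local Notation E := 'rV[R]_n.
Variables (f : E -> R) (g : E -> \bar R).
Hypothesis gNy : forall z, g z != -oo%E.
Implicit Types (gam : R) (x z w : E).

(** The proximal model is g plus this quadratic polynomial in z. *)
Definition smooth_model gam x z : R :=
  f x + dotrv (grad f x) (z - x) + (2 * gam)^-1 * enorm (z - x) ^+ 2.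

Lemma prox_modelE gam x z :
  prox_model f g gam x z = (g z + (smooth_model gam x z)%:E)%E.
Proof.
have := gNy z; rewrite /prox_model /lagrangian; case: (g z) => // r _.
rewrite -!EFinD; congr EFin; rewrite /smooth_model dotrvNl -dotrvNr opprB.
by rewrite -(enormN (x - z)) opprB div1r invfM; ring.
Qed.

(** For a quadratic function the first-order remainder is exactly its quadratic
    form, which yields the gradient below. *)
Lemma smooth_modelB gam x z w :
  smooth_model gam x w - smooth_model gam x z
  - dotrv (grad f x + gam^-1 *: (z - x)) (w - z)
  = (2 * gam)^-1 * enorm (w - z) ^+ 2.
Proof.
have wxE : w - x = (w - z) + (z - x) by rewrite addrA subrK.
rewrite /smooth_model !sqr_enorm wxE.
move: (w - z) (z - x) => a b; rewrite !dotrvE (dotrvC b a) invfM.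
by move: gam^-1 => i; field.
Qed.

Lemma smooth_model_gradient gam x :
  has_gradient (smooth_model gam x) (fun z => grad f x + gam^-1 *: (z - x)).
Proof.
move=> z e e0; pose c := n%:R * `|(2 * gam)^-1| + 1.
have c0 : 0 < c by rewrite ltr_wpDl ?mulr_ge0.
apply/nbhs_normP; exists (e / c); first by rewrite /= divr_gt0.
move=> w /= zw; rewrite smooth_modelB normrM (ger0_norm (sqr_ge0 _)).
rewrite expr2 mulrA ler_wpM2r ?enorm_ge0 //.
apply: (@le_trans _ _ (c * `|w - z|)); last first.
  by rewrite distrC mulrC -ler_pdivlMr // ltW.
apply: (@le_trans _ _ (`|(2 * gam)^-1| * (n%:R * `|w - z|))).
  by rewrite ler_wpM2l // enorm_le_normr.
by rewrite mulrA (mulrC `|_^-1|) ler_wpM2r // /c lerDl.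
Qed.

Lemma smooth_model_continuous gam x : continuous (smooth_model gam x).
Proof.
move=> z; have zx : w - x @[w --> z] --> z - x.
  exact: (cvgB (@cvg_id _ (nbhs z)) (cvg_cst x)).
have dzx : dotrv (grad f x) (w - x) @[w --> z] --> dotrv (grad f x) (z - x).
  exact: (dotrv_cvg _ (cvg_cst (grad f x)) zx).
have nzx : enorm (w - x) ^+ 2 @[w --> z] --> enorm (z - x) ^+ 2.
  by rewrite sqr_enorm; under eq_fun do rewrite sqr_enorm; exact: (dotrv_cvg _ zx zx).
exact: (cvgD (cvgD (cvg_cst (f x)) dzx) (cvgM (cvg_cst (2 * gam)^-1) nzx)).
Qed.

Lemma smooth_model_gradient_continuous gam x :
  continuous (fun z => grad f x + gam^-1 *: (z - x)).
Proof.
move=> z; have zx : w - x @[w --> z] --> z - x.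
  exact: (cvgB (@cvg_id _ (nbhs z)) (cvg_cst x)).
have gzx : gam^-1 *: (w - x) @[w --> z] --> gam^-1 *: (z - x).
  exact: (cvgZ (cvg_cst gam^-1) zx).
exact: (cvgD (cvg_cst (grad f x)) gzx).
Qed.

(** Completing the square, the objective of the proximal operator differs from
    the model by a quantity independent of the point. *)
Lemma prox_optimal gam x z w : 0 < gam ->
  prox gam g (x - gam *: grad f x) z ->
  (prox_model f g gam x z <= prox_model f g gam x w)%E.
Proof.
move=> gam0 /(_ w); rewrite !prox_modelE.
have sqE (a : E) : 1 / (2 * gam) * enorm (a - (x - gam *: grad f x)) ^+ 2 =
    smooth_model gam x a - f x + gam / 2 * enorm (grad f x) ^+ 2.
  rewrite /smooth_model !sqr_enorm opprB addrCA addrC.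
  move: (a - x) (grad f x) => u v; rewrite !dotrvE (dotrvC v u); field.
  by rewrite gt_eqF.
rewrite !sqE; have := gNy z; have := gNy w.
case: (g z) => [a| |] //; case: (g w) => [b| |] // _ _; rewrite ?leey //.
by rewrite -!EFinD !lee_fin => ?; lra.
Qed.

Lemma taylor_gap_step5 alpha gam x z :
  step5_fails f alpha gam x z =
  (alpha / (2 * gam) * enorm (z - x) ^+ 2 < taylor_gap f x z).
Proof. by rewrite /step5_fails /taylor_gap; apply/idP/idP => ?; lra. Qed.

(** Since g is above - |z|^2 / (2 gam2) up to a constant, 2 gam times the model
    grows at least like s |z|^2 with s = 1 - gam1 / gam2 > 0, for all gam <= gam1.
    Multiplying by 2 gam is what makes the bound uniform: the value of the
    model at the reference point w contains |w - x|^2 / (2 gam), which is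
    unbounded as gam tends to zero. *)
Lemma prox_model_sublevel_bounded (gam1 gam2 m M B C : R) :
  0 < gam1 -> gam1 < gam2 ->
  (forall z, m%:E <= g z + (1 / (2 * gam2) * enorm z ^+ 2)%:E)%E ->
  exists T : R, forall gam x w z, 0 < gam -> gam <= gam1 ->
    `|x| <= B -> `|w| <= B -> `|grad f x| <= C -> (g w <= M%:E)%E ->
    (prox_model f g gam x z <= prox_model f g gam x w)%E -> `|z| <= T.
Proof.
move=> gam10 gam12 gm.
pose N : R := n%:R.
have N0 : 0 <= N by rewrite ler0n.
pose a1 := 2 * gam1 * (N * C) + 2 * (N * B).
pose a0 := 2 * gam1 * (`|M| + `|m| + N * C * (3 * B)) + N * (2 * B) * (2 * B).
pose s := 1 - gam1 / gam2.
have gam20 : 0 < gam2 by exact: lt_trans gam12.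
have s0 : 0 < s by rewrite subr_gt0 ltr_pdivrMr // mul1r.
exists (1 + (a1 + a0) / s) => gam x w z gam0 gamle xB wB xC wM.
have B0 : 0 <= B by exact: le_trans xB.
have C0 : 0 <= C by exact: le_trans xC.
have a10 : 0 <= a1 by rewrite addr_ge0 ?mulr_ge0 // ltW.
have a00 : 0 <= a0 by rewrite addr_ge0 ?mulr_ge0 ?addr_ge0 ?mulr_ge0 // ltW.
rewrite !prox_modelE.
move: wM (gm z); have := gNy z; have := gNy w.
case: (g w) => [gw| |] //; case: (g z) => [gz| |] // _ _.
rewrite -!EFinD !lee_fin => wM mz le_model.
apply: (le_trans (normr_le_enorm _)); set t := enorm z.
have t0 : 0 <= t by exact: enorm_ge0.
have zt : `|z| <= t by exact: normr_le_enorm.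
have dz : `|dotrv (grad f x) (z - x)| <= N * C * (t + B).
  apply: (le_trans (normr_dotrv_le _ _)).
  rewrite ler_pM ?mulr_ge0 ?ler_wpM2l //.
  by rewrite (le_trans (ler_normB _ _)) // lerD.
have dw : `|dotrv (grad f x) (w - x)| <= N * C * (2 * B).
  apply: (le_trans (normr_dotrv_le _ _)).
  rewrite ler_pM ?mulr_ge0 ?ler_wpM2l //.
  by rewrite (le_trans (ler_normB _ _)) // mulr_natl mulr2n lerD.
have zx : `|dotrv z x| <= N * t * B.
  apply: (le_trans (normr_dotrv_le _ _)).
  by rewrite ler_pM ?mulr_ge0 ?ler_wpM2l.
have wx : enorm (w - x) ^+ 2 <= N * (2 * B) * (2 * B).
  rewrite sqr_enorm (le_trans (ler_norm _)) // (le_trans (normr_dotrv_le _ _)) //.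
  have wxB : `|w - x| <= 2 * B.
    by rewrite (le_trans (ler_normB _ _)) // mulr_natl mulr2n lerD.
  by rewrite ler_pM ?mulr_ge0 ?ler_wpM2l.
have x20 : 0 <= enorm x ^+ 2 by exact: sqr_ge0.
have zxE : enorm (z - x) ^+ 2 = t ^+ 2 - 2 * dotrv z x + enorm x ^+ 2.
  by rewrite !sqr_enorm !dotrvE (dotrvC x z); ring.
(* both sides of the comparison are multiplied by 2 gam *)
have key : s * t ^+ 2 <= a1 * t + a0.
  have le2 : gz + dotrv (grad f x) (z - x) + (2 * gam)^-1 * enorm (z - x) ^+ 2
    <= gw + dotrv (grad f x) (w - x) + (2 * gam)^-1 * enorm (w - x) ^+ 2.
    by move: le_model; rewrite /smooth_model; lra.
  have gam20' : 0 < 2 * gam by rewrite mulr_gt0.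
  have := ler_wpM2l (ltW gam20') le2.
  have mulK a b : 2 * gam * (a + (2 * gam)^-1 * b) = 2 * gam * a + b.
    by rewrite mulrDr mulVKf ?gt_eqF.
  rewrite !mulK zxE => le3.
  have gzm : m - 1 / (2 * gam2) * t ^+ 2 <= gz by move: mz; rewrite -/t; lra.
  have := ler_wpM2l (ltW gam20') gzm.
  have -> : 2 * gam * (m - 1 / (2 * gam2) * t ^+ 2) = 2 * gam * m - gam / gam2 * t ^+ 2.
    by field; rewrite gt_eqF.
  move=> le4.
  have le5 : gam / gam2 * t ^+ 2 <= gam1 / gam2 * t ^+ 2.
    by rewrite ler_wpM2r ?sqr_ge0 // ler_pM2r ?invr_gt0.
  have le6 : 2 * gam * (gw - m + dotrv (grad f x) (w - x) - dotrv (grad f x) (z - x))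
     <= 2 * gam1 * (`|M| + `|m| + N * C * (2 * B) + N * C * (t + B)).
    apply: (@le_trans _ _ (2 * gam * (`|M| + `|m| + N * C * (2 * B) + N * C * (t + B)))).
      rewrite ler_pM2l //; move: (ler_norm M) (ler_norm (- m)) dz dw.
      rewrite normrN !ler_norml => ? ? /andP[? ?] /andP[? ?]; lra.
    by rewrite ler_wpM2r ?ler_pM2l // !addr_ge0 ?mulr_ge0 ?addr_ge0.
  move: zx; rewrite ler_norml => /andP[? ?].
  rewrite /s /a1 /a0; lra.
(* if 1 < t then a0 <= a0 t, and key can be divided by t *)
have [t1|t1] := leP t 1.
  apply: (le_trans t1); rewrite lerDl; apply: divr_ge0; [exact: addr_ge0|exact: ltW].
apply: (@le_trans _ _ ((a1 + a0) / s)); last by rewrite lerDr.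
rewrite ler_pdivlMr // mulrC -(ler_pM2r (lt_trans ltr01 t1)) -mulrA -expr2.
apply: (le_trans key).
by rewrite [leRHS]mulrDl lerD2l ler_peMr // ltW.
Qed.

End prox_model.

(** * One iteration of the algorithm *)

Section panoc_iteration.
Context {R : realType} {n : nat}.
Local Notation E := 'rV[R]_n.
Variables (f : E -> R) (g : E -> \bar R) (D alpha beta : R).

(** The candidates for x_k, whatever the direction and the linesearch factor
    reached so far. *)
Definition trial_point (x0 xb0 x : E) : Prop := exists (t : R) (d : E),
  [/\ 0 < t <= 1, enorm d <= D * enorm (xb0 - x0) &
      x = (1 - t) *: xb0 + t *: (x0 + d)].

Lemma trial_point_bounded (y z u : E) B : 0 <= D -> `|y| <= B -> `|z| <= B ->
  trial_point y z u -> `|u| <= 2 * B + D * (n%:R * (2 * B)).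
Proof.
move=> D0 yB zB [t [e [/andP[t0 t1] eD ->]]].
have eB : `|e| <= D * (n%:R * (2 * B)).
  apply: (le_trans (normr_le_enorm _)); apply: (le_trans eD).
  rewrite ler_wpM2l // (le_trans (enorm_le_normr _)) // ler_wpM2l //.
  by rewrite (le_trans (ler_normB _ _)) // mulr_natl mulr2n lerD.
move: (D * _) eB => K eK.
apply: (le_trans (ler_normD _ _)); rewrite !normrZ (ger0_norm (ltW t0)).
rewrite ger0_norm ?subr_ge0 // mulr_natl mulr2n -addrA lerD //.
  by rewrite (le_trans _ zB) // ler_piMl // gerBl ltW.
apply: (le_trans (ler_piMl _ t1)) => //.
by apply: (le_trans (ler_normD _ _)); exact: lerD.
Qed.

(** The bounds on the direction are carried along because a failure of Step 6
    returns to Step 3 with the same direction. For the stepsize,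
    [Num.min gam0 c <= gam] is what survives repeated halving. *)
Definition control_invariant (gam0 : R) (x0 xb0 : E) (c : R) (s : control) :=
  let stepsize_ok gam := [/\ 0 < gam, gam <= gam0 & Num.min gam0 c <= gam] in
  let direction_ok d t := 0 < t <= 1 /\ enorm d <= D * enorm (xb0 - x0) in
  let model_ok gam x xb :=
    (prox_model f g gam x xb <= prox_model f g gam x xb0)%E in
  match s with
  | AtStep2 gam => stepsize_ok gam
  | AtStep3 gam d t => stepsize_ok gam /\ direction_ok d t
  | AtStep4 gam d t x => stepsize_ok gam /\ trial_point x0 xb0 x /\
      direction_ok d t
  | AtStep5 gam d t x xb => stepsize_ok gam /\ trial_point x0 xb0 x /\
      direction_ok d t /\ model_ok gam x xb
  | AtStep6 gam d t x xb => stepsize_ok gam /\ trial_point x0 xb0 x /\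
      direction_ok d t /\ model_ok gam x xb /\ ~~ step5_fails f alpha gam x xb
  | AtStep7 gam d t x xb => stepsize_ok gam /\ trial_point x0 xb0 x /\
      direction_ok d t /\ model_ok gam x xb /\ ~~ step5_fails f alpha gam x xb /\
      ~~ step6_fails f g alpha beta gam0 x0 xb0 gam x xb
  end.

(** A condition with two uses: for c = 0 it holds trivially, which gives access
    to the facts about accepted values that are true of every run; for bounded
    runs it holds with some c > 0 common to all iterations. *)
Definition backtracks_above (gam0 : R) (x0 xb0 : E) (c : R) : Prop :=
  forall gam x xb, 0 < gam -> gam <= gam0 -> trial_point x0 xb0 x ->
    (prox_model f g gam x xb <= prox_model f g gam x xb0)%E ->
    step5_fails f alpha gam x xb -> c <= gam / 2.

Lemma reach_invariant gam0 x0 xb0 c s : 0 < gam0 ->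
  backtracks_above gam0 x0 xb0 c ->
  reach f g D alpha beta gam0 x0 xb0 s -> control_invariant gam0 x0 xb0 c s.
Proof.
move=> gam00 above; elim => //=.
- by rewrite ge_min lexx.
- by move=> gam d _ ok dD; rewrite ltr01 lexx.
- move=> gam d t _ [ok [t01 dD]]; split=> //; split=> //; by exists t, d.
- by move=> gam d t x xb _ [? [? ?]] ?.
- move=> gam d t x xb _ [[gam_gt0 gam_le _] [tx [dok mok]]] fails.
  split; first by rewrite divr_gt0.
    by apply: le_trans gam_le; rewrite ler_pdivrMr // ler_peMr ?ler1n // ltW.
  by rewrite ge_min (above _ _ _ gam_gt0 gam_le tx mok fails) orbT.
- by move=> gam d t x xb _ [? [? [? ?]]] ?.
- move=> gam d t x xb _ [ok [tx [[/andP[t0 t1] dD] _]]] _; split=> //; split=> //.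
  apply/andP; split; first by rewrite divr_gt0.
  by apply: le_trans t1; rewrite ler_pdivrMr // ler_peMr ?ler1n // ltW.
- by move=> gam d t x xb _ [? [? [? [? ?]]]] ?.
Qed.

(** A stepsize is halved only after a failure of Step 5, hence never below c. *)
Lemma reach_step7 gam0 x0 xb0 c gam d t x xb : 0 < gam0 ->
  backtracks_above gam0 x0 xb0 c ->
  reach f g D alpha beta gam0 x0 xb0 (AtStep7 gam d t x xb) ->
  [/\ [/\ 0 < gam, gam <= gam0 & Num.min gam0 c <= gam],
      (prox_model f g gam x xb <= prox_model f g gam x xb0)%E,
      ~~ step5_fails f alpha gam x xb
    & ~~ step6_fails f g alpha beta gam0 x0 xb0 gam x xb].
Proof.
by move=> gam00 above /(reach_invariant gam00 above)[? [_ [_ [? [? ?]]]]].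
Qed.

Lemma backtracks_above0 gam0 x0 xb0 : backtracks_above gam0 x0 xb0 0.
Proof. by move=> gam y z gam_gt0 *; rewrite ltW // divr_gt0. Qed.

Lemma reach0_gt0 gam_init x0 xref gam : 0 < gam_init ->
  reach0 f g alpha gam_init x0 xref gam -> 0 < gam /\ gam <= gam_init.
Proof.
move=> gam0; elim => // {}gam xb _ [gam_gt0 gam_le] _ _.
split; first by rewrite divr_gt0.
by apply: le_trans gam_le; rewrite ler_pdivrMr // ler_peMr ?ler1n // ltW.
Qed.

End panoc_iteration.

(** * Infinite runs *)

Section panoc_run.
Context {R : realType} {n : nat}.
Local Notation E := 'rV[R]_n.
Variables (f : E -> R) (g : E -> \bar R) (D alpha beta : R).
Variables (gam_init : R) (x0 xref : E).
Variables (gam : nat -> R) (d : nat -> E) (tau : nat -> R) (x xb : nat -> E).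
Hypothesis gNy : forall z, g z != -oo%E.
Hypothesis gam_init_gt0 : 0 < gam_init.
Hypothesis alpha_01 : 0 < alpha < 1.
Hypothesis beta_01 : 0 < beta < 1.
Hypothesis xref_dom : dom g xref.
Hypothesis run : panoc_run f g D alpha beta gam_init x0 xref gam d tau x xb.

Local Notation model := (prox_model f g).

Lemma run_gam_gt0 k : 0 < gam k.
Proof.
elim: k => [|k IH].
  by have [_ [/(reach0_gt0 gam_init_gt0)[]]] := run.
have [_ _ /(_ k)] := run.
move=> /(reach_step7 IH (@backtracks_above0 _ _ f g D alpha _ _ _)).
by case=> -[].
Qed.

Lemma run_step k :
  [/\ gam k.+1 <= gam k,
      (model (gam k.+1) (x k.+1) (xb k.+1) <= model (gam k.+1) (x k.+1) (xb k))%E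
    & ~~ step6_fails f g alpha beta (gam k) (x k) (xb k)
         (gam k.+1) (x k.+1) (xb k.+1)].
Proof.
have [_ _ /(_ k)] := run.
move=> /(reach_step7 (run_gam_gt0 k)
  (@backtracks_above0 _ _ f g D alpha _ _ _)).
by case=> -[].
Qed.

Lemma run_step5 k : ~~ step5_fails f alpha (gam k) (x k) (xb k).
Proof.
case: k => [|k]; first by have [-> []] := run.
have [_ _ /(_ k)] := run.
move=> /(reach_step7 (run_gam_gt0 k)
  (@backtracks_above0 _ _ f g D alpha _ _ _)).
by case=> -[].
Qed.

Lemma run_gam_le k : gam k <= gam_init.
Proof.
elim: k => [|k IH]; last by have [/le_trans + _ _] := run_step k; exact.
by have [_ [/(reach0_gt0 gam_init_gt0)[]]] := run.
Qed.

Lemma prox_model_lt_pinfty c u z : (model c u z < +oo)%E = (g z < +oo)%E.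
Proof.
rewrite prox_modelE //; have := gNy z.
by case: (g z) => // r _; rewrite -EFinD !ltry.
Qed.

(** Step 4 compares the model with its value at the previous point, so that
    finiteness propagates from the reference point. *)
Lemma run_dom k : dom g (xb k).
Proof.
rewrite /dom /=; elim: k => [|k IH].
  have [_ [_ le_model _] _] := run.
  rewrite -(prox_model_lt_pinfty (gam 0%N) x0).
  by apply: (le_lt_trans le_model); rewrite prox_model_lt_pinfty.
have [_ le_model _] := run_step k.
rewrite -(prox_model_lt_pinfty (gam k.+1) (x k.+1)).
by apply: (le_lt_trans le_model); rewrite prox_model_lt_pinfty.
Qed.

Lemma run_g_fin k : g (xb k) = (fine (g (xb k)))%:E.
Proof.
by have := run_dom k; have := gNy (xb k); rewrite /dom /=; case: (g (xb k)).
Qed.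

Definition merit k : R := fine (g (xb k)) + smooth_model f (gam k) (x k) (xb k).

Lemma Phi_merit k : Phi f g gam x xb k = (merit k)%:E.
Proof. by rewrite /Phi prox_modelE // run_g_fin -EFinD. Qed.

Definition residual k : R := enorm (xb k - x k) ^+ 2 / gam k.

Lemma residual_ge0 k : 0 <= residual k.
Proof. by rewrite divr_ge0 ?sqr_ge0 // ltW // run_gam_gt0. Qed.

(** The test of Step 5 bounds f xb_k by its linearisation plus a fraction alpha of
    the quadratic term of the model; the remaining fraction is the surplus. *)
Lemma cost_le_merit k :
  fine (g (xb k)) + f (xb k) + (1 - alpha) / 2 * residual k <= merit k.
Proof.
have := run_step5 k; rewrite /step5_fails -leNgt /merit /smooth_model /residual.
rewrite !invfM; move: (gam k)^-1 (enorm _ ^+ 2) (dotrv _ _) => i e p.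
move: (f _) (f _) (fine _) => a b c H; lra.
Qed.

Lemma merit_decrease k :
  merit k.+1 <= merit k - beta * (1 - alpha) / 2 * residual k.
Proof.
have [_ _] := run_step k; rewrite /step6_fails -leNgt.
rewrite -/(Phi f g gam x xb k) -/(Phi f g gam x xb k.+1) !Phi_merit.
rewrite -EFinD lee_fin /residual !invfM.
move: (gam k)^-1 (enorm _ ^+ 2) => i e H; lra.
Qed.

Lemma onem_alpha_gt0 : 0 < (1 - alpha) / 2.
Proof. by have /andP[_ a1] := alpha_01; rewrite divr_gt0 // subr_gt0. Qed.

Lemma decrease_rate_gt0 : 0 < beta * (1 - alpha) / 2.
Proof. by have /andP[b0 _] := beta_01; rewrite -mulrA mulr_gt0 ?onem_alpha_gt0. Qed.

Lemma merit_noninc k : merit k <= merit 0.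
Proof.
elim: k => // k IH; apply: le_trans IH; apply: (le_trans (merit_decrease k)).
by rewrite gerBl mulr_ge0 ?residual_ge0 // ltW // decrease_rate_gt0.
Qed.

Variable m : R.
Hypothesis cost_ge : forall z, (m%:E <= cost f g z)%E.

Lemma run_cost k : cost f g (xb k) = (f (xb k) + fine (g (xb k)))%:E.
Proof. by rewrite /cost run_g_fin. Qed.

Lemma merit_ge k : m + (1 - alpha) / 2 * residual k <= merit k.
Proof.
apply: le_trans (cost_le_merit k); rewrite lerD2r addrC.
by have := cost_ge (xb k); rewrite run_cost lee_fin.
Qed.

Lemma merit_cvg : merit @ \oo --> limn merit.
Proof.
apply: nonincreasing_is_cvgn.
  apply/nonincreasing_seqP => k; apply: (le_trans (merit_decrease k)).
  by rewrite gerBl mulr_ge0 ?residual_ge0 // ltW // decrease_rate_gt0.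
exists m => _ [k _ <-]; apply: le_trans (merit_ge k); rewrite lerDl.
by rewrite mulr_ge0 ?residual_ge0 // ltW // onem_alpha_gt0.
Qed.

(** The residual is squeezed between 0 and a multiple of a difference of
    consecutive terms of a convergent sequence. *)
Lemma residual_cvg0 : residual @ \oo --> 0.
Proof.
pose c := beta * (1 - alpha) / 2.
have c0 : 0 < c := decrease_rate_gt0.
have dcvg : c^-1 * (merit k - merit k.+1) @[k --> \oo] --> 0.
  rewrite -(mulr0 c^-1) -(subrr (limn merit)).
  apply: cvgM; first exact: cvg_cst.
  apply: cvgB; first exact: merit_cvg.
  by have := merit_cvg; rewrite -(cvg_shiftS merit).
apply: (squeeze_cvgr _ (cvg_cst 0) dcvg).
apply: nearW => k; rewrite residual_ge0 /= mulrC ler_pdivlMr // mulrC.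
have := merit_decrease k; rewrite -/c; lra.
Qed.

Lemma proximal_step_cvg0 : xb k - x k @[k --> \oo] --> (0 : E).
Proof.
apply/cvgr0Pnorm_le => e e0.
have e20 : 0 < e ^+ 2 / gam_init by rewrite divr_gt0 ?exprn_gt0.
have res_lt := cvgr_lt _ residual_cvg0 _ e20.
suff step_le k : residual k < e ^+ 2 / gam_init -> `|xb k - x k| <= e.
  by case: res_lt => N _ res; exists N => // k /res /step_le.
rewrite /residual ltr_pdivrMr ?run_gam_gt0 // => lte.
apply: (le_trans (normr_le_enorm _)).
rewrite -(ler_pXn2r (n := 2)) ?nnegrE ?enorm_ge0 ?(ltW e0) //.
apply: (le_trans (ltW lte)); rewrite mulrAC ler_pdivrMr //.
by rewrite ler_wpM2l ?sqr_ge0 // run_gam_le.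
Qed.

(** The cost at xb_k is at most Phi_0, which bounds xb_k. The residuals are at most
    a multiple of Phi_0 - m; as gam_k <= gam_init, this bounds xb_k - x_k. *)
Lemma coercive_bounded : coercive (cost f g) -> bounded_fun x /\ bounded_fun xb.
Proof.
move=> /(_ (merit 0 + 1))[r cost_r].
have xb_r k : `|xb k| <= r.
  apply: (le_trans (normr_le_enorm _)); rewrite leNgt; apply/negP => /ltW /cost_r.
  rewrite run_cost lee_fin => cost_gt.
  have := le_trans (cost_le_merit k) (merit_noninc k).
  have : 0 <= (1 - alpha) / 2 * residual k.
    by rewrite mulr_ge0 ?residual_ge0 // ltW // onem_alpha_gt0.
  move: (_ * residual k) cost_gt => a; lra.
split; last exact: norm_bounded_fun xb_r.
pose s := (merit 0 - m) / ((1 - alpha) / 2) * gam_init.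
apply: (@norm_bounded_fun _ _ _ (r + (1 + s))) => k.
have -> : x k = xb k - (xb k - x k) by rewrite opprB addrC subrK.
apply: (le_trans (ler_normB _ _)); rewrite lerD //.
apply: (le_trans (normr_le_enorm _)).
have sq_s : enorm (xb k - x k) ^+ 2 <= s.
  have -> : enorm (xb k - x k) ^+ 2 = residual k * gam k.
    by rewrite divfK // gt_eqF // run_gam_gt0.
  rewrite ler_pM ?residual_ge0 ?run_gam_le ?(ltW (run_gam_gt0 _)) //.
  rewrite ler_pdivlMr ?onem_alpha_gt0 // mulrC.
  have := le_trans (merit_ge k) (merit_noninc k).
  move: (_ * residual k) => a; lra.
(* t <= 1 + t ^ 2 turns the bound on the square into a bound on the norm *)
have := enorm_ge0 (xb k - x k); move: (enorm _) sq_s => t sq_s t0.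
have [t1|t1] := leP t 1.
  by rewrite (le_trans t1) // lerDl (le_trans _ sq_s) // sqr_ge0.
by rewrite (le_trans _ (le_trans sq_s _)) ?lerDr // expr2 ler_peMl // ltW.
Qed.

Hypothesis D_ge0 : 0 <= D.
Hypothesis f_diff : forall z, differentiable f z.
Hypothesis f_grad_lip : locally_lipschitz (grad f).

(** Boundedness of the accepted iterates extends to all tried points, where one
    Taylor constant L is valid; a failure of Step 5 then forces
    alpha / (2 gam) < L, that is, alpha / (4 L) < gam / 2. *)
Lemma run_gam_bounded_below (gam2 m2 : R) : gam_init < gam2 ->
  (forall z, m2%:E <= g z + (1 / (2 * gam2) * enorm z ^+ 2)%:E)%E ->
  bounded_fun x -> bounded_fun xb ->
  exists2 c, 0 < c & forall k, c <= gam k.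
Proof.
move=> gam_lt gm2 /bounded_fun_gt0[B1 B10 xB1] /bounded_fun_gt0[B2 B20 xbB2].
pose B := Num.max B1 B2.
have xB k : `|x k| <= B by rewrite le_max xB1.
have xbB k : `|xb k| <= B by rewrite le_max xbB2 orbT.
have B0 : 0 < B by rewrite lt_max B10.
pose B' := 2 * B + D * (n%:R * (2 * B)).
have BB' : B <= B'.
  have B2E : 2 * B = B + B by rewrite mulr_natl mulr2n.
  by rewrite /B' B2E -addrA lerDl addr_ge0 ?mulr_ge0 ?addr_ge0 // ltW.
have [Cf fC] : exists C : R, forall z, `|z| <= B' -> `|f z| <= C.
  by apply: continuous_bounded_on_ball => z; exact: differentiable_continuous.
have [Cg gC] := continuous_bounded_on_ball B' (locally_lipschitz_continuous f_grad_lip).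
have g_le k : (g (xb k) <= (merit 0 + Cf)%:E)%E.
  rewrite run_g_fin lee_fin.
  have := le_trans (cost_le_merit k) (merit_noninc k).
  have : 0 <= (1 - alpha) / 2 * residual k.
    by rewrite mulr_ge0 ?residual_ge0 // ltW // onem_alpha_gt0.
  have := fC _ (le_trans (xbB k) BB'); rewrite ler_norml => /andP[].
  move: (_ * residual k) => a; lra.
have [T trialT] := prox_model_sublevel_bounded f gNy (merit 0 + Cf) B' Cg
  gam_init_gt0 gam_lt gm2.
have [L L0 gapL] := taylor_gap_compact f_diff f_grad_lip
  (@closed_ball_rV_compact R n (Num.max B' T)).
pose c := alpha / (4 * L).
have /andP[alpha0 _] := alpha_01.
have c0 : 0 < c by rewrite divr_gt0 // mulr_gt0.
have above k : backtracks_above f g D alpha (gam k) (x k) (xb k) c.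
  move=> gm y z gm0 gmle tp le_model fails.
  have yB' : `|y| <= B' by exact: trial_point_bounded tp.
  have zT : `|z| <= T.
    apply: (trialT gm y (xb k) z) => //.
    - exact: le_trans gmle (run_gam_le k).
    - exact: le_trans (xbB k) BB'.
    - exact: gC.
  have gapyz : taylor_gap f y z <= L * enorm (z - y) ^+ 2.
    by apply: gapL; rewrite /= le_max ?yB' // zT orbT.
  rewrite taylor_gap_step5 in fails.
  have lt_L : alpha / (2 * gm) < L.
    rewrite ltNge; apply/negP => Lle.
    have := lt_le_trans fails gapyz; rewrite ltNge => /negP; apply.
    by rewrite ler_wpM2r ?sqr_ge0.
  rewrite ler_pdivrMr ?mulr_gt0 //.
  move: lt_L; rewrite ltr_pdivrMr ?mulr_gt0 // => lt_L.
  have -> : gm / 2 * (4 * L) = L * (2 * gm) by field.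
  exact: ltW.
exists (Num.min (gam 0) c); first by rewrite lt_min run_gam_gt0.
elim=> [|k IH]; first by rewrite ge_min lexx.
have [_ _ /(_ k)] := run; move=> /(reach_step7 (run_gam_gt0 k) (above k)).
case=> [[_ _ le_gam] _ _ _]; apply: le_trans le_gam.
by rewrite le_min IH ge_min lexx orbT.
Qed.

(** * Limit points of bounded runs *)

Variable c : R.
Hypothesis c_gt0 : 0 < c.
Hypothesis gam_ge : forall k, c <= gam k.
Hypothesis g_lsc : lower_semicontinuous g.

Let f_continuous : continuous f.
Proof. by move=> z; exact: (differentiable_continuous (f_diff z)). Qed.

Let grad_continuous : continuous (grad f).
Proof. exact: locally_lipschitz_continuous. Qed.

Let f_has_gradient : has_gradient f (grad f).
Proof. by move=> z e e0; exact: grad_first_order. Qed.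

Lemma subdiff_cost z v : subdiff g z v -> subdiff (cost f g) z (v + grad f z).
Proof.
have -> : cost f g = (fun z => (g z + (f z)%:E)%E).
  by apply/funext => w; rewrite /cost addeC.
exact: subdiffD.
Qed.

Section extraction.
Variables (phi : nat -> nat) (a : E).
Hypothesis phi_ge : forall k, (k <= phi k)%N.
Hypothesis xb_phi : xb (phi k) @[k --> \oo] --> a.

Let phi_cvg : phi @ \oo --> \oo := extraction_cvg phi_ge.

Lemma x_extraction_cvg : x (phi k) @[k --> \oo] --> a.
Proof.
have step_phi := cvg_comp _ (fun k => xb k - x k) phi_cvg proximal_step_cvg0.
have -> : (fun k => x (phi k)) = (fun k => xb (phi k) - (xb (phi k) - x (phi k))).
  by apply/funext => k; rewrite opprB addrC subrK.
by rewrite -[a]subr0; exact: (cvgB xb_phi step_phi).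
Qed.

(** Lower semicontinuity along g(xb_k) <= Phi_k - f(xb_k). *)
Lemma g_cluster_le : (g a <= (limn merit - f a)%:E)%E.
Proof.
have merit_phi := cvg_comp _ merit phi_cvg merit_cvg.
have f_phi := cvg_comp _ f xb_phi (@f_continuous a).
apply: (lsc_le_lim g_lsc xb_phi (cvgB merit_phi f_phi)).
move=> k; rewrite run_g_fin lee_fin lerBrDr.
apply: le_trans (cost_le_merit _); rewrite lerDl mulr_ge0 ?residual_ge0 //.
by rewrite ltW // onem_alpha_gt0.
Qed.

Lemma cluster_dom : dom g a.
Proof. by rewrite /dom /=; apply: (le_lt_trans g_cluster_le); rewrite ltry. Qed.

(** This is where the lower bound c on the stepsizes enters: the vanishing of
    the residuals alone does not make (xb_k - x_k) / gam_k tend to zero. *)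
Lemma model_gradient_cvg :
  grad f (x (phi k)) + (gam (phi k))^-1 *: (xb (phi k) - x (phi k)) @[k --> \oo]
    --> grad f a.
Proof.
rewrite -[X in _ --> X]addr0; apply: cvgD.
  exact: (cvg_comp _ (grad f) x_extraction_cvg (@grad_continuous a)).
have step_phi := cvg_comp _ (fun k => xb k - x k) phi_cvg proximal_step_cvg0.
apply/cvgr0Pnorm_le => e e0.
have ce0 : 0 < c * e by rewrite mulr_gt0.
have [N _ stepN] := cvgr0_norm_le _ step_phi _ ce0.
exists N => // k /stepN /= stepk; rewrite normrZ ger0_norm ?invr_ge0 ?(ltW (run_gam_gt0 _)) //.
rewrite ler_pdivrMl ?run_gam_gt0 // (le_trans stepk) //.
by rewrite ler_wpM2r // ltW.
Qed.

End extraction.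

(** The distance to the subdifferential is an infimum that need not be attained,
    hence the slack 1/(k+1) in the choice of the subgradients. Two successive
    extractions make both xb_k and these subgradients converge. *)
Lemma delta_stationary_cluster delta xs :
  delta_stationary f g delta gam x xb ->
  closed_relative_to (graph_subdiff g) (dom g `*` setT) ->
  cluster (xb @ \oo) xs ->
  (dist0 (subdiff (cost f g) xs) <= delta%:E)%E.
Proof.
move=> stat [C Ccl CE] /cluster_extraction[phi phi_ge xb_phi].
have [w wP] : {w : nat -> E & forall k,
    subdiff (prox_model f g (gam k) (x k)) (xb k) (w k) /\
    enorm (w k) < delta + k.+1%:R^-1}.
  apply: (@choice _ _ (fun k v =>
    subdiff (prox_model f g (gam k) (x k)) (xb k) v /\
    enorm v < delta + k.+1%:R^-1)) => k.
  have : (dist0 (subdiff (prox_model f g (gam k) (x k)) (xb k))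
      < (delta + k.+1%:R^-1)%:E)%E.
    by apply: le_lt_trans (stat k) _; rewrite lte_fin ltrDl invr_gt0.
  by move=> /ereal_inf_lt[_ [v vsub <-]]; rewrite lte_fin => ?; exists v.
pose v k := w k - (grad f (x k) + (gam k)^-1 *: (xb k - x k)).
have vP k : subdiff g (xb k) (v k).
  have [wk _] := wP k.
  apply: (subdiffB gNy (smooth_model_gradient f (gam k) (x k))).
  - exact: smooth_model_continuous.
  - exact: smooth_model_gradient_continuous.
  have <- // : prox_model f g (gam k) (x k) =
      (fun z => (g z + (smooth_model f (gam k) (x k) z)%:E)%E).
  by apply/funext => z; rewrite prox_modelE.
have wB k : `|w (phi k)| <= delta + 1.
  apply: (le_trans (normr_le_enorm _)); have [_ /ltW/le_trans] := wP (phi k).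
  by apply; rewrite lerD2l invf_le1 ?ler1n.
have [ws /cluster_extraction[psi psi_ge w_psi]] := bounded_cluster wB.
pose theta := phi \o psi.
have theta_ge k : (k <= theta k)%N by exact: leq_trans (psi_ge k) (phi_ge _).
have xb_theta : xb (theta k) @[k --> \oo] --> xs.
  exact: (cvg_comp psi (xb \o phi) (extraction_cvg psi_ge) xb_phi).
have v_theta : v (theta k) @[k --> \oo] --> ws - grad f xs.
  exact: (cvgB w_psi (model_gradient_cvg theta_ge xb_theta)).
have ws_delta : enorm ws <= delta.
  have lim_bound : delta + k.+1%:R^-1 @[k --> \oo] --> delta.
    rewrite -[X in _ --> X]addr0.
    by apply: cvgD; [exact: cvg_cst|exact: cvg_harmonic].
  apply: (ler_cvg_to (enorm_cvg _ w_psi) lim_bound).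
  apply: nearW => k; have [_ /ltW/le_trans] := wP (theta k); apply.
  by rewrite lerD2l lef_pV2 ?posrE // ler_nat ltnS.
have C_lim : C (xs, ws - grad f xs).
  apply: (@closed_cvg _ _ \oo _ (fun k => (xb (theta k), v (theta k))) C Ccl).
    apply: nearW => k; have : graph_subdiff g (xb (theta k), v (theta k)) by exact: vP.
    by rewrite CE => -[].
  exact: (cvg_pair xb_theta v_theta).
have gv : subdiff g xs (ws - grad f xs).
  have : graph_subdiff g (xs, ws - grad f xs).
    by rewrite CE; split => //; split => //=; exact: cluster_dom xb_theta.
  by [].
apply: (@le_trans _ _ (enorm ws)%:E); last by rewrite lee_fin.
apply: ereal_inf_lbound; exists ws => //.
by have := subdiff_cost gv; rewrite subrK.
Qed.

(** If z is close to xs then, along the extraction, it eventually lies in the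
    ball around xb_k where local optimality applies; the limit of the
    resulting inequality is taken with (2 gam_k)^-1 replaced by (2 c)^-1. *)
Lemma locally_optimal_limit_le (r : \bar R) (eps : nat -> R) (xs : E) :
  (0 < r)%E -> eps @ \oo --> 0 ->
  (\forall k \near \oo, locally_optimal_with f g r eps gam x xb k) ->
  cluster (xb @ \oo) xs ->
  \forall z \near xs, ((limn merit)%:E <= g z +
    (f xs + dotrv (grad f xs) (z - xs) + (2 * c)^-1 * enorm (z - xs) ^+ 2)%:E)%E.
Proof.
move=> r0 eps0 [N _ optN] /cluster_extraction[phi phi_ge xb_phi].
have phi_cvg := extraction_cvg phi_ge.
have [s s0 sr] : exists2 s : R, 0 < s & (s%:E <= r)%E.
  move: r0; case: r {optN} => [r| |] //; first by exists r.
  by exists 1; rewrite ?leey.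
(* two sup-norm distances below rho add up to a Euclidean distance at most s *)
pose rho := s / (2 * (n%:R + 1)).
have n1 : 0 < n%:R + 1 :> R by rewrite ltr_wpDl.
have rho0 : 0 < rho by rewrite divr_gt0 // mulr_gt0.
have near_xs : \forall z \near xs, `|xs - z| < rho by apply/nbhs_normP; exists rho.
apply: filterS near_xs => z zrho.
have := gNy z; case gzE : (g z) => [b| |] // _; last by rewrite leey.
rewrite -EFinD lee_fin.
pose ub k := b + (f (x (phi k)) + dotrv (grad f (x (phi k))) (z - x (phi k))
   + (2 * c)^-1 * enorm (z - x (phi k)) ^+ 2) + eps (phi k).
have xphi := x_extraction_cvg phi_ge xb_phi.
have zx : z - x (phi k) @[k --> \oo] --> z - xs by apply: cvgB => //; exact: cvg_cst.
have ub_cvg : ub @ \oo --> b + (f xs + dotrv (grad f xs) (z - xs)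
   + (2 * c)^-1 * enorm (z - xs) ^+ 2).
  rewrite -[X in _ --> X]addr0; apply: cvgD; last exact: (cvg_comp _ eps phi_cvg eps0).
  apply: cvgD; first exact: cvg_cst.
  apply: cvgD; first apply: cvgD.
  - exact: (cvg_comp _ f xphi (@f_continuous xs)).
  - exact: (dotrv_cvg _ (cvg_comp _ (grad f) xphi (@grad_continuous xs)) zx).
  apply: cvgM; first exact: cvg_cst.
  by under eq_fun do rewrite sqr_enorm; rewrite sqr_enorm; exact: dotrv_cvg.
apply: (ler_cvg_to (cvg_comp _ merit phi_cvg merit_cvg) ub_cvg).
have [M _ xbM] := cvgr_dist_lt _ _ xb_phi _ rho0.
exists (maxn N M) => // k /=; rewrite geq_max => /andP[Nk Mk].
have := optN (phi k) (leq_trans Nk (phi_ge k)) z.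
have -> : (((enorm (z - xb (phi k)))%:E <= r)%E = true).
  apply: le_trans sr; rewrite lee_fin (le_trans (enorm_le_normr _)) //.
  have zxb : `|z - xb (phi k)| <= 2 * rho.
    have -> : z - xb (phi k) = (z - xs) + (xs - xb (phi k)) by rewrite addrA subrK.
    apply: (le_trans (ler_normD _ _)); rewrite mulr_natl mulr2n lerD //.
      by rewrite distrC ltW.
    by rewrite ltW //; exact: xbM.
  apply: (@le_trans _ _ ((n%:R + 1) * (2 * rho))).
    by rewrite ler_pM // lerDl.
  by rewrite /rho le_eqVlt; apply/orP; left; apply/eqP; field; rewrite gt_eqF.
move=> /(_ isT).
rewrite -/(Phi f g gam x xb (phi k)) Phi_merit prox_modelE // gzE -!EFinD lee_fin.
move=> /le_trans; apply; rewrite /ub lerD2r lerD2l /smooth_model lerD2l.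
rewrite ler_wpM2r ?sqr_ge0 // lef_pV2 ?posrE ?mulr_gt0 ?run_gam_gt0 //.
by rewrite ler_pM2l.
Qed.

(** At z = xs the limit inequality and [g_cluster_le] identify the cost with
    lim Phi. Substituting this value back, g lies above an affine function with
    slope - grad f xs, up to a quadratic error, which is o(|z - xs|). *)
Lemma locally_optimal_cluster (r : \bar R) (eps : nat -> R) (xs : E) :
  (0 < r)%E -> eps @ \oo --> 0 ->
  (\forall k \near \oo, locally_optimal_with f g r eps gam x xb k) ->
  cluster (xb @ \oo) xs ->
  subdiff (cost f g) xs 0 /\ cost f g xs = (limn merit)%:E.
Proof.
move=> r0 eps0 opt xs_cl.
have le_lim := locally_optimal_limit_le r0 eps0 opt xs_cl.
have [phi phi_ge xb_phi] := cluster_extraction xs_cl.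
have := g_cluster_le phi_ge xb_phi; have := gNy xs.
case gxE : (g xs) => [a| |] // _; rewrite lee_fin => a_le.
have := nbhs_singleton le_lim.
rewrite gxE subrr enorm0 dotrv0r expr0n mulr0 !addr0.
rewrite -EFinD lee_fin => le_a.
have aE : a + f xs = limn merit by apply/eqP; rewrite eq_le le_a andbT; lra.
split; last by rewrite /cost gxE -EFinD addrC aE.
suff gv : subdiff g xs (- grad f xs).
  by have := subdiff_cost gv; rewrite addNr.
apply: regular_subdiff_subdiff => //; apply/regular_subdiffP => //.
split; first by rewrite /dom /= gxE ltry.
move=> e e0; pose K := (2 * c)^-1 * n%:R + 1.
have K0 : 0 < K by rewrite ltr_wpDl // mulr_ge0 // invr_ge0 mulr_ge0 // ltW.
have near_xs : \forall z \near xs, `|xs - z| < e / K.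
  by apply/nbhs_normP; exists (e / K) => //=; rewrite divr_gt0.
apply: filterS2 near_xs le_lim => z; rewrite ltr_pdivlMr // => zK.
rewrite gxE -aE; have := gNy z; case: (g z) => [b| |] // _; last by move=> _; rewrite leey.
rewrite -!EFinD !lee_fin dotrvNl => le_b.
have quad_le : (2 * c)^-1 * enorm (z - xs) ^+ 2 <= e * enorm (z - xs).
  rewrite expr2 mulrA ler_wpM2r ?enorm_ge0 //.
  apply: le_trans (ltW zK); rewrite mulrC distrC.
  apply: (@le_trans _ _ (n%:R * `|z - xs| * (2 * c)^-1)).
    by rewrite ler_wpM2r ?enorm_le_normr // invr_ge0 mulr_ge0 // ltW.
  by rewrite mulrAC mulrC ler_wpM2l // mulrC /K lerDl.
lra.
Qed.

End panoc_run.

Theorem theorem4p6 (R : realType) (n : nat)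
    (f : 'rV[R]_n -> R) (g : 'rV[R]_n -> \bar R) (gamma_g : \bar R)
    (f_diff : forall x : 'rV[R]_n, differentiable f x)
    (f_grad_lip : locally_lipschitz (grad f))
    (g_proper : proper_function g)
    (g_lsc : lower_semicontinuous g)
    (gamma_g_def : gamma_g = prox_threshold g)
    (gamma_g_gt0 : (0 < gamma_g)%E)
    (cost_bounded_below : (-oo < ereal_inf (range (cost f g)))%E)
    (gam_init D alpha beta : R) (x0 xref : 'rV[R]_n)
    (gam_init_gt0 : 0 < gam_init)
    (gam_init_lt : (gam_init%:E < gamma_g)%E)
    (D_ge0 : 0 <= D)
    (alpha_01 : 0 < alpha < 1)
    (beta_01 : 0 < beta < 1)
    (xref_dom : dom g xref)
    (gam : nat -> R) (d : nat -> 'rV[R]_n) (tau : nat -> R)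
    (x xb : nat -> 'rV[R]_n)
    (run : panoc_run f g D alpha beta gam_init x0 xref gam d tau x xb)
    (x_neq_xb : forall k, x k != xb k) :
  [/\ coercive (cost f g) -> bounded_fun x /\ bounded_fun xb,
      (\forall k \near \oo,
         prox (gam k) g (x k - gam k *: grad f (x k)) (xb k)) ->
      \forall k \near \oo,
         locally_optimal_with f g +oo%E (fun=> 0) gam x xb k
    & bounded_fun x -> bounded_fun xb ->
      (forall delta : R, 0 < delta ->
         delta_stationary f g delta gam x xb ->
         closed_relative_to (graph_subdiff g) (dom g `*` setT) ->
         forall xs, cluster (xb @ \oo) xs ->
           (dist0 (subdiff (cost f g) xs) <= delta%:E)%E)
      /\
      (eventually_uniformly_locally_optimal f g gam x xb ->
         exists phi_star : R,
           Phi f g gam x xb @ \oo --> phi_star%:E /\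
           forall xs, cluster (xb @ \oo) xs ->
             subdiff (cost f g) xs 0 /\ cost f g xs = phi_star%:E)].
Proof.
have [gNy _] := g_proper.
have [m cost_ge] : exists m : R, forall z, (m%:E <= cost f g z)%E.
  have inf_le z : (ereal_inf (range (cost f g)) <= cost f g z)%E.
    by apply: ereal_inf_lbound; exists z.
  case: (ereal_inf _) cost_bounded_below inf_le => [r| |] // _ inf_le.
    by exists r.
  by exists 0 => z; apply: le_trans (inf_le z); rewrite leey.
split.
- exact: (coercive_bounded gNy gam_init_gt0 alpha_01 beta_01 xref_dom run cost_ge).
- move=> [N _ xb_prox]; exists N => // k /xb_prox xb_opt z _.
  rewrite adde0; apply: prox_optimal xb_opt => //.
  exact: (run_gam_gt0 gam_init_gt0 run).
move=> x_bnd xb_bnd.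
have [gam2 gam_lt [m2 gm2]] : exists2 gam2 : R, gam_init < gam2 & exists m2 : R,
    forall z, (m2%:E <= g z + (1 / (2 * gam2) * enorm z ^+ 2)%:E)%E.
  move: gam_init_lt; rewrite gamma_g_def => /ereal_sup_gt[_ [gam2 [_ gm2] <-]].
  by rewrite lte_fin; exists gam2.
have [c c_gt0 gam_ge] := run_gam_bounded_below gNy gam_init_gt0 alpha_01 beta_01
  xref_dom run D_ge0 f_diff f_grad_lip gam_lt gm2 x_bnd xb_bnd.
split=> [delta _ stat closed_graph xs|].
  exact: (delta_stationary_cluster gNy gam_init_gt0 alpha_01 beta_01
    xref_dom run cost_ge f_diff f_grad_lip c_gt0 gam_ge g_lsc stat closed_graph).
move=> [r [eps [r0 _ _ eps0 opt]]].
exists (limn (merit f g gam x xb)); split.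
  rewrite (_ : Phi _ _ _ _ _ = EFin \o merit f g gam x xb).
    apply: cvg_EFin; first exact: nearW.
    exact: (merit_cvg gNy gam_init_gt0 alpha_01 beta_01 xref_dom run cost_ge).
  by apply/funext => k; rewrite /= (Phi_merit gNy gam_init_gt0 xref_dom run).
move=> xs.
exact: (locally_optimal_cluster gNy gam_init_gt0 alpha_01 beta_01
    xref_dom run cost_ge f_diff f_grad_lip c_gt0 gam_ge g_lsc r0 eps0 opt).
Qed.
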